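(* Let $0<\alpha\leq 1$ and let $p$ be an analytic function on $\mathbb{D}$ with $p(0)=1$. Each of the following conditions is sufficient for $p(z)\prec\left(\frac{1+z}{1-z}\right)^{\alpha}$: (a) $p(z)+\beta zp'(z)\prec\left(\frac{1+z}{1-z}\right)^{\alpha}$ with $\beta>0$; (b) $p(z)+\beta\,\frac{zp'(z)}{p(z)}\prec\left(\frac{1+z}{1-z}\right)^{\alpha}$ with $\beta>0$; (c) $p(z)+\beta\,\frac{zp'(z)}{p^{2}(z)}\prec\left(\frac{1+z}{1-z}\right)^{\alpha}$, where either $0<\alpha<\frac12$ and $\beta>0$, or $\frac12<\alpha\leq 1$ and $\beta<0$.
   Context: $\mathbb{D}$ is the open unit disc in $\mathbb{C}$. $\beta$ is real. For analytic functions $f,g$ on $\mathbb{D}$, $f\prec g$ ($f$ is subordinate to $g$) means there is an analytic $w:\mathbb{D}\to\mathbb{D}$ with $w(0)=0$ and $f(z)=g(w(z))$ for all $z\in\mathbb{D}$; in particular a subordination hypothesis includes that its left-hand side is analytic on $\mathbb{D}$. The power $\left(\frac{1+z}{1-z}\right)^{\alpha}$ is the principal branch (value $1$ at $z=0$). *)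

(* Defs.v *)
From Stdlib Require Import Reals Lra.
From Coquelicot Require Import Coquelicot.

Open Scope R_scope.

Definition unit_disc (z : C) : Prop := Cmod z < 1.

(* Functions on the disc are represented by total functions [C -> C]; since the
   disc is open, complex differentiability (and [C_derive]) at its points does
   not depend on the values outside. *)
Definition analytic_on_disc (f : C -> C) : Prop :=
  forall z : C, unit_disc z ->
    ex_derive (K := C_AbsRing) (V := C_NormedModule) f z.

Definition subordinate (f g : C -> C) : Prop :=
  analytic_on_disc f /\ analytic_on_disc g /\
  exists w : C -> C,
    analytic_on_disc w /\
    (forall z : C, unit_disc z -> unit_disc (w z)) /\
    w (RtoC 0) = RtoC 0 /\
    (forall z : C, unit_disc z -> f z = g (w z)).

(* Principal argument, in (-PI, PI]; meaningful for [z] nonzero. *)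
Definition Carg (z : C) : R :=
  if Rle_dec 0 (Im z) then acos (Re z / Cmod z) else - acos (Re z / Cmod z).

Definition Cexp (z : C) : C :=
  (exp (Re z) * cos (Im z), exp (Re z) * sin (Im z)).

Definition Clog (z : C) : C := (ln (Cmod z), Carg z).

(* Principal branch of the power with real exponent, for [z] nonzero. *)
Definition Cpower (z : C) (a : R) : C := Cexp (RtoC a * Clog z)%C.

(* On the unit disc the base lies in the right half-plane, where the principal
   branch is analytic. *)
Definition sector_map (alpha : R) (z : C) : C :=
  Cpower ((1 + z) / (1 - z))%C alpha.

(* In a hypothesis such as
     [subordinate (fun z => p z + beta * (z * C_derive p z / p z))%C
                  (sector_map alpha)]
   division is total, with inverse 0 at 0 ([Cinv_0]), so the left-hand side is 0 wherever [p]
   is, whereas [sector_map alpha], being an exponential, never vanishes.  The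
   hypothesis therefore entails that [p] has no zero on the disc, i.e. that the
   quotient is genuinely defined there. *)
Lemma sector_map_neq_0 (alpha : R) (z : C) : sector_map alpha z <> RtoC 0.
Proof.
unfold sector_map, Cpower, Cexp; set (u := Cmult _ _); intros H.
pose proof (exp_pos (Re u)) as He.
assert (Hc := f_equal fst H); assert (Hs := f_equal snd H).
cbn [fst snd RtoC] in Hc, Hs.
apply Rmult_integral in Hc; apply Rmult_integral in Hs.
pose proof (sin2_cos2 (Im u)) as H1; unfold Rsqr in H1.
destruct Hc as [Hc|Hc]; [lra|].
destruct Hs as [Hs|Hs]; [lra|].
rewrite Hc, Hs in H1; lra.
Qed.

(* Main.v *)
(* The range of [sector_map alpha] is the sector [|arg w| < theta], with
   [theta = alpha PI / 2], so it is enough that [p] stays in this sector: then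
   [w = (P - 1) / (P + 1)] with [P = p ^ (1 / alpha)] realizes the subordination.
   Otherwise take [z] of least modulus with [p z] outside the sector.  Then
   [p z = r exp (i s theta)] with [s = 1] or [s = -1] and [r >= 0], and the linear
   form [L] vanishing on this ray is nonnegative on [p y] for [|y| < |z|].
   Differentiating [L o p] at [z] in the inward directions gives
   [z p'(z) = i s k exp (i s theta)] with [k >= 0], a weak form of Jack's lemma.
   With this value, [L] is nonpositive at each of
   [p + beta z p'], [p + beta z p' / p] and [p + beta z p' / p ^ 2] (in the last
   case because [beta cos (2 theta) >= 0]), whereas it is positive on the sector. *)
Require Import Defs.
From Stdlib Require Import Reals Lra Classical IndefiniteDescription.
From Coquelicot Require Import Coquelicot.
Open Scope R_scope.

(** * Complex derivatives as first-order expansions *)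

Lemma is_derive_C_iff (f : C -> C) (z l : C) :
  is_derive (K := C_AbsRing) (V := C_NormedModule) f z l <->
  forall eps, 0 < eps -> exists delta, 0 < delta /\
    forall h : C, Cmod h < delta ->
      Cmod (f (z + h) - f z - h * l)%C <= eps * Cmod h.
Proof.
split.
- intros [_ H] eps He.
  destruct (H z (fun P HP => HP) (mkposreal eps He)) as [d Hd].
  exists d; split; [apply cond_pos|].
  intros h Hh.
  specialize (Hd (z + h)%C).
  assert (E : minus (z + h)%C z = h).
  { unfold minus, plus, opp; simpl. ring. }
  change (Cmod (minus (z + h)%C z) < d -> Cmod (minus (minus (f (z+h)%C) (f z)) (Cmult (minus (z+h)%C z) l)) <= eps * Cmod (minus (z+h)%C z)) in Hd.
  rewrite E in Hd. exact (Hd Hh).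
- intros H. split; [apply is_linear_scal_l|].
  (* The filter derivative quantifies over every limit [x] of the neighbourhoods of [z]; separation
     leaves only [z]. *)
  intros x Hx.
  assert (z = x) as <-.
  { apply (is_filter_lim_locally_unique (V := AbsRing_NormedModule C_AbsRing)); exact Hx. }
  intros [eps He].
  destruct (H eps He) as (d & Hd & Hh).
  exists (mkposreal d Hd). intros y Hy.
  change (Cmod (minus y z) < d) in Hy.
  specialize (Hh (minus y z) Hy).
  assert (E : (z + (y - z))%C = y) by ring.
  change (Cmod (f (z + (y - z)) - f z - (y - z) * l)%C <= eps * Cmod (y - z)%C)
    in Hh.
  rewrite E in Hh; exact Hh.
Qed.

(* Coquelicot puts two normed module structures on [C]; the chain and product
   rules only apply with the one of [AbsRing_NormedModule]. *)
Lemma is_derive_C_AbsRing (f : C -> C) (z l : C) :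
  is_derive (K := C_AbsRing) (V := C_NormedModule) f z l <->
  is_derive (K := C_AbsRing) (V := AbsRing_NormedModule C_AbsRing) f z l.
Proof.
split; intros [_ H]; (split; [apply is_linear_scal_l|exact H]).
Qed.

(** * Real linear forms along [f] at a boundary point, and first exit from a sector *)

Lemma linear_form_le (a b : R) (w : C) :
  Rabs (a * Re w + b * Im w) <= (Rabs a + Rabs b) * Cmod w.
Proof.
pose proof (Rmax_Cmod w) as H.
pose proof (Rmax_l (Rabs (fst w)) (Rabs (snd w))).
pose proof (Rmax_r (Rabs (fst w)) (Rabs (snd w))).
unfold Re, Im.
eapply Rle_trans; [apply Rabs_triang|].
rewrite !Rabs_mult.
pose proof (Rabs_pos a); pose proof (Rabs_pos b); nra.
Qed.

Lemma Cmod_lt_sqr (z w : C) :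
  Re z ^ 2 + Im z ^ 2 < Re w ^ 2 + Im w ^ 2 -> Cmod z < Cmod w.
Proof.
intros H; unfold Cmod; apply sqrt_lt_1_alt; split; [|exact H].
pose proof (pow2_ge_0 (fst z)); pose proof (pow2_ge_0 (snd z)); lra.
Qed.

(* The directions [zeta] with negative real part are those for which
   [z (1 + t zeta)] enters the disc of radius [|z|] as [t] leaves 0. *)
Lemma inward_derivative_ge_0 (f : C -> C) (z l : C) (a b : R) (zeta : C) :
  is_derive (K := C_AbsRing) (V := C_NormedModule) f z l ->
  (forall y : C, Cmod y < Cmod z -> 0 <= a * Re (f y) + b * Im (f y)) ->
  a * Re (f z) + b * Im (f z) = 0 ->
  Re zeta < 0 ->
  0 <= a * Re (z * l * zeta)%C + b * Im (z * l * zeta)%C.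
Proof.
intros Hd Hpos H0 Hz.
destruct (Rle_lt_dec 0 (a * Re (z * l * zeta)%C + b * Im (z * l * zeta)%C))
  as [H|Hm]; [exact H|exfalso].
set (m := - (a * Re (z * l * zeta)%C + b * Im (z * l * zeta)%C)).
assert (m0 : 0 < m) by (unfold m; lra).
assert (z0 : 0 < Cmod z).
{ apply Cmod_gt_0; intros E; unfold m in m0; rewrite E in m0.
  revert m0; simpl; lra. }
set (K := Rabs a + Rabs b).
assert (HK : 0 <= K)
  by (unfold K; pose proof (Rabs_pos a); pose proof (Rabs_pos b); lra).
set (M := Cmod (z * zeta)%C).
assert (HM : 0 <= M) by apply Cmod_ge_0.
assert (HKM : 0 <= K * M) by (apply Rmult_le_pos; assumption).
(* At step size [t] the form of the error term is at most [K * eps * t * M], which this [eps] bounds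
   by [t * (m / 2)]. *)
set (eps := m / (2 * (K * M + 1))).
assert (He : 0 < eps) by (apply Rdiv_lt_0_compat; lra).
assert (HeK : eps * (K * M) <= m / 2).
{ replace (m / 2) with (eps * (K * M + 1)) by (unfold eps; field; lra). lra. }
destruct (proj1 (is_derive_C_iff f z l) Hd eps He) as (d & d0 & Hdelta).
set (S := Re zeta ^ 2 + Im zeta ^ 2).
assert (S0 : 0 <= S) by (unfold S; nra).
(* The first bound puts the increment within [d]. The second gives [t * S <= - Re zeta], hence [|1 +
   t zeta|^2 = 1 + 2 t Re zeta + t^2 S < 1]. *)
set (t := Rmin (d / (2 * (M + 1))) (- Re zeta / (S + 1))).
assert (t1 : t <= d / (2 * (M + 1))) by apply Rmin_l.
assert (t2 : t <= - Re zeta / (S + 1)) by apply Rmin_r.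
assert (t0 : 0 < t) by (apply Rmin_pos; apply Rdiv_lt_0_compat; lra).
assert (tM : t * M < d).
{ apply Rle_lt_trans with (d / (2 * (M + 1)) * M); [nra|].
  apply Rlt_le_trans with (d / (2 * (M + 1)) * (2 * (M + 1))).
  apply Rmult_lt_compat_l; [apply Rdiv_lt_0_compat|]; lra.
  right; field; lra. }
assert (tS : t * S <= - Re zeta).
{ apply Rle_trans with (- Re zeta / (S + 1) * (S + 1)).
  - apply Rle_trans with (- Re zeta / (S + 1) * S); [nra|].
    apply Rmult_le_compat_l; [|lra].
    apply Rlt_le, Rdiv_lt_0_compat; lra.
  - right; field; lra. }
assert (Hh : Cmod (t * (z * zeta))%C = t * M).
{ unfold M; rewrite Cmod_mult, Cmod_R, Rabs_pos_eq; lra. }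
specialize (Hdelta (t * (z * zeta))%C).
rewrite Hh in Hdelta; specialize (Hdelta tM).
assert (Hy : Cmod (z + t * (z * zeta))%C < Cmod z).
{ replace (z + t * (z * zeta))%C with (z * (1 + t * zeta))%C by ring.
  rewrite Cmod_mult.
  assert (Cmod (1 + t * zeta)%C < 1); [|nra].
  rewrite <- Cmod_1 at 2. apply Cmod_lt_sqr.
  unfold S in tS; destruct zeta as [x y]; simpl in *; nra. }
specialize (Hpos _ Hy).
pose proof (linear_form_le a b
  (f (z + t * (z * zeta)) - f z - t * (z * zeta) * l)%C) as HL.
fold K in HL.
assert (HL2 : Rabs (a * Re (f (z + t * (z * zeta)) - f z - t * (z * zeta) * l)%C
  + b * Im (f (z + t * (z * zeta)) - f z - t * (z * zeta) * l)%C) <= t * (m / 2)).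
{ eapply Rle_trans; [exact HL|].
  apply Rle_trans with (K * (eps * (t * M))); [nra|].
  nra. }
apply Rabs_le_between in HL2; destruct HL2 as [_ HL2].
(* As the form vanishes at [f z], its value at the moved point is at most [t * (m / 2) - t * m < 0],
   against [Hpos]. *)
assert (E : a * Re (f (z + t * (z * zeta)) - f z - t * (z * zeta) * l)%C
  + b * Im (f (z + t * (z * zeta)) - f z - t * (z * zeta) * l)%C =
  (a * Re (f (z + t * (z * zeta))%C) + b * Im (f (z + t * (z * zeta))%C))
  - (a * Re (f z) + b * Im (f z)) + t * m).
{ unfold m; generalize (f (z + t * (z * zeta))%C) (f z); intros u v.
  destruct z, zeta, l, u, v; simpl; ring. }
nra.
Qed.

(** The direction [-1] gives the inequality. The directions [- e + i] and [- e - i], with [e] small,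
    bound the second expression from both sides and force it to be 0. *)
Lemma boundary_derivative (f : C -> C) (z l : C) (a b : R) :
  is_derive (K := C_AbsRing) (V := C_NormedModule) f z l ->
  (forall y : C, Cmod y < Cmod z -> 0 <= a * Re (f y) + b * Im (f y)) ->
  a * Re (f z) + b * Im (f z) = 0 ->
  a * Re (z * l)%C + b * Im (z * l)%C <= 0 /\
  b * Re (z * l)%C - a * Im (z * l)%C = 0.
Proof.
intros Hd Hpos H0.
pose proof (fun zeta => inward_derivative_ge_0 f z l a b zeta Hd Hpos H0) as H.
destruct (z * l)%C as [x y]; simpl in H |- *.
split.
- specialize (H (-1, 0)); simpl in H; lra.
- set (u := a * x + b * y).
  set (v := b * x - a * y).
  assert (H1 : forall e, 0 < e -> e * u <= v).
  { intros e He; specialize (H (- e, 1)); simpl in H; unfold u, v; lra. }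
  assert (H2 : forall e, 0 < e -> e * u <= - v).
  { intros e He; specialize (H (- e, -1)); simpl in H; unfold u, v; lra. }
  pose proof (H1 1 Rlt_0_1). pose proof (H2 1 Rlt_0_1).
  destruct (Req_dec v 0) as [E|E]; [exact E|exfalso].
  assert (0 < Rabs v) by (apply Rabs_pos_lt, E).
  (* [H1] and [H2] together say [e * u <= - Rabs v], whereas this [e] makes [e * Rabs u] smaller
     than [Rabs v]. *)
  set (e := Rabs v / (2 * (Rabs u + 1))).
  pose proof (Rabs_pos u).
  assert (He : 0 < e) by (apply Rdiv_lt_0_compat; lra).
  assert (e * Rabs u < Rabs v).
  { apply Rlt_le_trans with (e * (2 * (Rabs u + 1))).
    apply Rmult_lt_compat_l; lra. right; unfold e; field; lra. }
  specialize (H1 e He); specialize (H2 e He).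
  assert (- (e * u) <= e * Rabs u).
  { rewrite Ropp_mult_distr_r. apply Rmult_le_compat_l; [lra|].
    rewrite <- Rabs_Ropp; apply Rle_abs. }
  destruct (Rle_dec 0 v);
    [assert (Rabs v = v) by (apply Rabs_pos_eq; lra)
    |assert (Rabs v = - v) by (apply Rabs_left; lra)]; lra.
Qed.

(** Preimages of open half-planes are open. This serves for the two half-planes of the sector and,
    with signs reversed, for the exterior of each. *)
Lemma linear_form_pos_locally (f : C -> C) (z l : C) (a b : R) :
  is_derive (K := C_AbsRing) (V := C_NormedModule) f z l ->
  0 < a * Re (f z) + b * Im (f z) ->
  exists d, 0 < d /\ forall y : C, Cmod (y - z)%C < d ->
    0 < a * Re (f y) + b * Im (f y).
Proof.
intros Hd Hpos.
set (m := a * Re (f z) + b * Im (f z)) in *.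
set (K := Rabs a + Rabs b).
assert (HK : 0 <= K)
  by (unfold K; pose proof (Rabs_pos a); pose proof (Rabs_pos b); lra).
destruct (proj1 (is_derive_C_iff f z l) Hd 1 Rlt_0_1) as (d & d0 & Hdelta).
(* With tolerance 1 in the expansion, [f] moves by at most [Cmod l + 1] times the increment, and the
   form by at most [K] times that; [K + 1] keeps [N] positive. *)
set (N := (K + 1) * (Cmod l + 1)).
assert (HN : 0 < N).
{ unfold N; pose proof (Cmod_ge_0 l); apply Rmult_lt_0_compat; lra. }
exists (Rmin d (m / N)); split.
{ apply Rmin_pos; [assumption|apply Rdiv_lt_0_compat; assumption]. }
intros y Hy.
assert (H1 : Cmod (y - z)%C < d) by (eapply Rlt_le_trans; [exact Hy|apply Rmin_l]).
assert (H2 : Cmod (y - z)%C < m / N)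
  by (eapply Rlt_le_trans; [exact Hy|apply Rmin_r]).
specialize (Hdelta _ H1).
replace (z + (y - z))%C with y in Hdelta by ring.
pose proof (Cmod_triangle (f y - f z - (y - z) * l)%C ((y - z) * l)%C) as H3.
replace (f y - f z - (y - z) * l + (y - z) * l)%C with (f y - f z)%C in H3 by ring.
rewrite Cmod_mult in H3.
assert (H4 : Cmod (f y - f z)%C <= Cmod (y - z)%C * (Cmod l + 1)) by lra.
assert (H5 : K * Cmod (f y - f z)%C < m).
{ apply Rle_lt_trans with (Cmod (y - z)%C * N).
  - unfold N; pose proof (Cmod_ge_0 (y - z)%C); pose proof (Cmod_ge_0 l).
    assert (0 <= Cmod (y - z)%C * (Cmod l + 1)) by (apply Rmult_le_pos; lra).
    pose proof (Rmult_le_compat_l K _ _ HK H4).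
    replace (Cmod (y - z)%C * ((K + 1) * (Cmod l + 1))) with
      (K * (Cmod (y - z)%C * (Cmod l + 1)) + Cmod (y - z)%C * (Cmod l + 1)) by ring.
    lra.
  - apply Rmult_lt_compat_r with (r := N) in H2; [|exact HN].
    replace (m / N * N) with m in H2 by (field; lra). exact H2. }
pose proof (linear_form_le a b (f y - f z)%C) as H6; fold K in H6.
assert (H7 : a * Re (f y - f z)%C + b * Im (f y - f z)%C =
  a * Re (f y) + b * Im (f y) - m).
{ unfold m; generalize (f y) (f z); intros u v; destruct u, v; simpl; ring. }
apply Rabs_le_between in H6; lra.
Qed.

(* The least modulus is the supremum of the radii of the discs contained in
   [P]; were it not attained outside [P], compactness would give a larger disc. *)
Lemma minimal_modulus_outside (P : C -> Prop) (z1 : C) :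
  (forall z, P z \/ ~ P z) ->
  (forall z, Cmod z <= Cmod z1 -> P z ->
     exists d, 0 < d /\ forall y, Cmod (y - z)%C < d -> P y) ->
  ~ P z1 -> P (RtoC 0) ->
  exists z0, Cmod z0 <= Cmod z1 /\ ~ P z0 /\ forall y, Cmod y < Cmod z0 -> P y.
Proof.
intros Hdec Hopen Hz1 HP0.
set (E := fun r => forall y, Cmod y <= r -> P y).
assert (HE0 : E 0).
{ intros y Hy. rewrite (Cmod_eq_0 y); [exact HP0|].
  pose proof (Cmod_ge_0 y); lra. }
assert (HEb : is_upper_bound E (Cmod z1)).
{ intros r Hr; apply Rnot_lt_le; intros H; apply Hz1, Hr; lra. }
destruct (completeness E) as [r [Hub Hlub]].
{ exists (Cmod z1); exact HEb. }
{ exists 0; exact HE0. }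
assert (r0 : 0 <= r) by (apply Hub, HE0).
assert (r1 : r <= Cmod z1) by (apply Hlub, HEb).
assert (Hin : forall y, Cmod y < r -> P y).
{ intros y Hy. destruct (Hdec y) as [H|H]; [exact H|exfalso].
  assert (r <= Cmod y); [|lra].
  apply Hlub; intros s Hs; apply Rnot_lt_le; intros H'; apply H, Hs; lra. }
destruct (classic (exists z0, Cmod z0 = r /\ ~ P z0)) as [(z0 & H1 & H2)|Hno].
{ exists z0; rewrite H1; auto. }
exfalso.
assert (Hcl : forall y, Cmod y <= r -> P y).
{ intros y [Hy|Hy]; [auto|].
  destruct (Hdec y) as [H|H]; [exact H|exfalso; apply Hno; exists y; auto]. }
(* The gauge for compactness: around a point of the closed disc, a radius on which [P] holds; around
   a point outside, a third of its distance to the disc, so that it cannot cover points near the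
   disc. *)
assert (Hdelta : forall u v : R, exists d : posreal,
  (Cmod (u, v) <= r -> forall y, Cmod (y - (u, v))%C < 2 * d -> P y) /\
  (r < Cmod (u, v) -> 3 * d = Cmod (u, v) - r)).
{ intros u v. destruct (Rle_lt_dec (Cmod (u, v)) r) as [H|H].
  - destruct (Hopen (u, v)) as (d & d0 & Hd); [lra|auto|].
    assert (d1 : 0 < d / 2) by lra.
    exists (mkposreal _ d1); simpl; split; [|lra].
    intros _ y Hy; apply Hd; lra.
  - assert (d1 : 0 < (Cmod (u, v) - r) / 3) by lra.
    exists (mkposreal _ d1); simpl; split; [lra|]. intros _; lra. }
set (delta := fun u v => proj1_sig (constructive_indefinite_description _ (Hdelta u v))).
destruct (compactness_value_2d (- (r + 1)) (r + 1) (- (r + 1)) (r + 1) delta)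
  as [d Hd].
(* The bound 1 keeps the enlarged disc inside the square covered by compactness. *)
assert (HE : E (r + Rmin d 1)).
{ intros y Hy. apply NNPP; intros Hy'.
  pose proof (Rmin_l d 1) as m1; pose proof (Rmin_r d 1) as m2.
  pose proof (Rmax_Cmod y) as Hm.
  pose proof (Rmax_l (Rabs (fst y)) (Rabs (snd y))).
  pose proof (Rmax_r (Rabs (fst y)) (Rabs (snd y))).
  apply (Hd (fst y) (snd y)); [apply Rabs_le_between; lra|apply Rabs_le_between; lra|].
  intros (u & v & _ & _ & Hu & Hv & Hduv).
  unfold delta in Hu, Hv, Hduv.
  destruct (constructive_indefinite_description _ (Hdelta u v)) as [e [He1 He2]].
  simpl in Hu, Hv, Hduv.
  (* The gauge controls each coordinate separately; [sqrt 2 < 2] turns this into a distance, whence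
     the factor 2 in [Hdelta]. *)
  assert (Hyuv : Cmod (y - (u, v))%C < 2 * e).
  { pose proof (Cmod_2Rmax (y - (u, v))%C) as H2.
    assert (H3 : Rmax (Rabs (fst (y - (u, v))%C)) (Rabs (snd (y - (u, v))%C)) < e)
      by (apply Rmax_lub_lt; assumption).
    assert (H4 : sqrt 2 < 2).
    { rewrite <- (sqrt_square 2) at 2 by lra. apply sqrt_lt_1; lra. }
    pose proof (sqrt_pos 2).
    pose proof (cond_pos e).
    apply Rle_lt_trans with (sqrt 2 * e); [|nra].
    eapply Rle_trans; [exact H2|]. apply Rmult_le_compat_l; lra. }
  destruct (Rle_lt_dec (Cmod (u, v)) r) as [H1|H1].
  - apply Hy', (He1 H1), Hyuv.
  (* A centre outside the disc would have modulus less than [r + d + 2 e <= r + 3 e], which is its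
     own modulus. *)
  - specialize (He2 H1).
    pose proof (Cmod_triangle y (- (y - (u, v)))%C) as H2.
    rewrite Cmod_opp in H2.
    assert (H3 : forall c : C, (y + - (y - c))%C = c) by (intros c; ring).
    rewrite H3 in H2; lra. }
apply Hub in HE.
assert (0 < Rmin d 1) by (apply Rmin_pos; [apply cond_pos|lra]).
lra.
Qed.

(* For [0 < theta <= PI / 2] this is [|arg w| < theta], as an intersection of two
   open half-planes. *)
Definition in_sector (theta : R) (w : C) : Prop :=
  0 < sin theta * Re w + - cos theta * Im w /\
  0 < sin theta * Re w + cos theta * Im w.

(** The sign [s] names the side reached. [- k] is the value at [z p'(z)] of the form vanishing on
    that side, nonpositive by [boundary_derivative], and [r] is the coordinate of [p z] along it;
    [r = 0] is an exit through the vertex. *)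
Lemma sector_exit (theta : R) (p : C -> C) :
  0 < theta <= PI / 2 ->
  analytic_on_disc p -> p (RtoC 0) = RtoC 1 ->
  ~ (forall z, unit_disc z -> in_sector theta (p z)) ->
  exists (z : C) (s k r : R),
    unit_disc z /\ (s = 1 \/ s = -1) /\ 0 <= k /\ 0 <= r /\
    p z = (r * cos theta, s * (r * sin theta)) /\
    (z * C_derive p z)%C = (- (k * sin theta), s * (k * cos theta)).
Proof.
intros Ht Hp Hp0 Hn.
pose proof PI_RGT_0.
assert (Hsin : 0 < sin theta) by (apply sin_gt_0; lra).
assert (Hcos : 0 <= cos theta) by (apply cos_ge_0; lra).
pose proof (sin2_cos2 theta) as H1; unfold Rsqr in H1.
apply not_all_ex_not in Hn as [z1 Hn].
apply imply_to_and in Hn as [Hz1 Hn].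
unfold unit_disc in Hz1.
assert (Hder : forall z, Cmod z <= Cmod z1 ->
  is_derive (K := C_AbsRing) (V := C_NormedModule) p z (C_derive p z)).
{ intros z Hz; apply C_derive_correct; [exact z|apply Hp; unfold unit_disc; lra]. }
destruct (minimal_modulus_outside (fun z => in_sector theta (p z)) z1)
  as (z & Hz & Hnz & Hmin).
- intros z; apply classic.
- intros z Hz [Ha Hb].
  destruct (linear_form_pos_locally _ _ _ _ _ (Hder z Hz) Ha) as (d1 & d10 & Hd1).
  destruct (linear_form_pos_locally _ _ _ _ _ (Hder z Hz) Hb) as (d2 & d20 & Hd2).
  exists (Rmin d1 d2); split; [apply Rmin_pos; assumption|].
  intros y Hy; split; [apply Hd1|apply Hd2];
    (eapply Rlt_le_trans; [exact Hy|]); [apply Rmin_l|apply Rmin_r].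
- exact Hn.
- rewrite Hp0; split; simpl; lra.
- specialize (Hder z Hz).
  (* Were a form negative at [p z], it would by continuity be negative at [p ((1 - t) z)] for small
     [t], where minimality makes it positive. *)
  assert (Hge : forall s, s = 1 \/ s = -1 ->
    0 <= sin theta * Re (p z) + - s * cos theta * Im (p z)).
  { intros s Hs. apply Rnot_lt_le; intros Hlt.
    destruct (linear_form_pos_locally p z (C_derive p z) (- sin theta)
      (s * cos theta) Hder) as (d & d0 & Hd); [lra|].
    assert (z0 : 0 < Cmod z).
    { apply Cmod_gt_0; intros E; rewrite E, Hp0 in Hlt; simpl in Hlt; lra. }
    set (t := Rmin (1 / 2) (d / (2 * Cmod z))).
    assert (t1 : t <= 1 / 2) by apply Rmin_l.
    assert (t2 : t <= d / (2 * Cmod z)) by apply Rmin_r.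
    assert (t0 : 0 < t) by (apply Rmin_pos; [|apply Rdiv_lt_0_compat]; lra).
    assert (t3 : t * Cmod z < d).
    { apply Rle_lt_trans with (d / (2 * Cmod z) * Cmod z).
      apply Rmult_le_compat_r; lra.
      replace (d / (2 * Cmod z) * Cmod z) with (d / 2) by (field; lra). lra. }
    destruct (Hmin (RtoC (1 - t) * z)%C) as [Ha Hb].
    { rewrite Cmod_mult, Cmod_R, Rabs_pos_eq by lra. nra. }
    specialize (Hd (RtoC (1 - t) * z)%C).
    replace (RtoC (1 - t) * z - z)%C with (RtoC (- t) * z)%C in Hd
      by (rewrite RtoC_minus, RtoC_opp; ring).
    rewrite Cmod_mult, Cmod_R, Rabs_Ropp, Rabs_pos_eq in Hd by lra.
    specialize (Hd t3).
    destruct Hs as [-> | ->]; lra. }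
  assert (Hs : exists s, (s = 1 \/ s = -1) /\
    sin theta * Re (p z) + - s * cos theta * Im (p z) = 0 /\
    0 <= cos theta * Re (p z) + s * sin theta * Im (p z)).
  { pose proof (Hge 1 (or_introl eq_refl)) as G1.
    pose proof (Hge (-1) (or_intror eq_refl)) as G2.
    assert (Ga : 0 <= Re (p z)) by nra.
    assert (Hcase : exists s, (s = 1 \/ s = -1) /\
      sin theta * Re (p z) + - s * cos theta * Im (p z) = 0).
    { destruct (Rlt_le_dec 0 (sin theta * Re (p z) + - 1 * cos theta * Im (p z))).
      - exists (-1); split; [auto|].
        destruct (Rle_lt_or_eq_dec _ _ G2) as [G3|G3]; [|lra].
        exfalso; apply Hnz; split; lra.
      - exists 1; split; [auto|lra]. }
    destruct Hcase as (s & Hs & E).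
    destruct Hcos as [Hcos|Hcos].
    - exists s; split; [exact Hs|]; split; [exact E|].
      assert (Hcc : 0 <= cos theta * (cos theta * Re (p z) + s * sin theta * Im (p z))).
      { replace (cos theta * (cos theta * Re (p z) + s * sin theta * Im (p z)))
          with (Re (p z) * (sin theta * sin theta + cos theta * cos theta)
            - sin theta * (sin theta * Re (p z) + - s * cos theta * Im (p z))) by ring.
        rewrite H1, E; lra. }
      apply Rnot_lt_le; intros Hlt; nra.
    (* When [cos theta = 0] the two forms coincide and both sides lie on the imaginary axis, so the
       sign of [Im (p z)] selects the side. *)
    - rewrite <- Hcos in *.
      destruct (Rle_dec 0 (Im (p z))) as [Hi|Hi].
      + exists 1; split; [auto|]; split; [lra|nra].
      + exists (-1); split; [auto|]; split; [lra|nra]. }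
  destruct Hs as (s & Hs & E & Hr).
  assert (Hss : s * s = 1) by (destruct Hs as [-> | ->]; ring).
  destruct (boundary_derivative p z (C_derive p z) (sin theta) (- s * cos theta)
    Hder) as [B1 B2].
  { intros y Hy; destruct (Hmin y Hy) as [Ha Hb].
    destruct Hs as [-> | ->]; lra. }
  { exact E. }
  exists z, s, (- (sin theta * Re (z * C_derive p z)%C
    + - s * cos theta * Im (z * C_derive p z)%C)),
    (cos theta * Re (p z) + s * sin theta * Im (p z)).
  split; [unfold unit_disc; lra|].
  split; [exact Hs|].
  split; [lra|].
  split; [exact Hr|].
  revert E B2; clear - H1 Hss.
  generalize (z * C_derive p z)%C (p z); intros [v1 v2] [u1 u2]; simpl.
  generalize dependent (sin theta); generalize (cos theta).
  (* Each component is rebuilt from the coordinates along and across the side, by [t^2 + c^2 = 1]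
     and [s^2 = 1]. *)
  intros c t H1 E B2; split; f_equal.
  + transitivity (u1 * (t * t + c * c) - t * (t * u1 + - s * c * u2)); [|ring].
    rewrite E, H1; ring.
  + transitivity (s * s * (t * t + c * c) * u2 + s * c * (t * u1 + - s * c * u2));
      [|ring].
    rewrite E, H1, Hss; ring.
  + transitivity (v1 * (t * t + c * c) + c * c * v1 * (s * s - 1) + s * c * (- s * c * v1 - t * v2)); [|ring].
    rewrite B2, H1, Hss; ring.
  + transitivity (v2 * (t * t + c * c) + c * c * v2 * (s * s - 1) + t * (- s * c * v1 - t * v2)); [|ring].
    rewrite B2, H1, Hss; ring.
Qed.

(** * The principal logarithm on the right half-plane *)

(** [1 - (Re w / |w|)^2] is the square of [Im w / |w|], and the case split in [Carg] restores the
    sign lost in the square root. The [atan] form gives access to its bounds and to [cos_atan],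
    [sin_atan]. *)
Lemma Carg_atan (w : C) : 0 < Re w -> Carg w = atan (Im w / Re w).
Proof.
intros Hw.
assert (Hm : 0 < Cmod w)
  by (apply Cmod_gt_0; intros E; rewrite E in Hw; simpl in Hw; lra).
assert (H2 : Cmod w ^ 2 = Re w ^ 2 + Im w ^ 2) by apply Cmod2_alt.
unfold Carg.
rewrite acos_atan by (apply Rdiv_lt_0_compat; assumption).
replace (1 - (Re w / Cmod w)²) with ((Im w / Cmod w)²).
2: { unfold Rsqr.
  replace (Im w / Cmod w * (Im w / Cmod w)) with (Im w ^ 2 / Cmod w ^ 2) by (field; lra).
  replace (Im w ^ 2) with (Cmod w ^ 2 - Re w ^ 2) by lra. field; lra. }
rewrite sqrt_Rsqr_abs, Rabs_div by lra.
rewrite (Rabs_pos_eq (Cmod w)) by lra.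
destruct (Rle_dec 0 (Im w)) as [H|H].
- rewrite Rabs_pos_eq by lra. f_equal; field; lra.
- rewrite Rabs_left by lra. rewrite <- atan_opp. f_equal; field; lra.
Qed.

Lemma Cexp_Clog (w : C) : 0 < Re w -> Cexp (Clog w) = w.
Proof.
intros Hw.
assert (Hm : 0 < Cmod w)
  by (apply Cmod_gt_0; intros E; rewrite E in Hw; simpl in Hw; lra).
unfold Cexp, Clog; simpl.
rewrite exp_ln, Carg_atan by assumption.
rewrite cos_atan, sin_atan.
assert (E : sqrt (1 + (Im w / Re w)²) = Cmod w / Re w).
{ rewrite <- (sqrt_Rsqr (Cmod w / Re w)) by (apply Rlt_le, Rdiv_lt_0_compat; lra).
  f_equal. unfold Rsqr.
  replace (Cmod w / Re w * (Cmod w / Re w)) with (Cmod w ^ 2 / Re w ^ 2) by (field; lra).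
  rewrite Cmod2_alt; field; lra. }
rewrite E. destruct w as [x y]; simpl in *. f_equal; field; lra.
Qed.

Lemma Cmod_Cexp (u : C) : Cmod (Cexp u) = exp (Re u).
Proof.
unfold Cmod, Cexp; simpl.
transitivity (sqrt (exp (Re u) * exp (Re u)));
  [|apply sqrt_square, Rlt_le, exp_pos].
f_equal; pose proof (sin2_cos2 (Im u)) as H; unfold Rsqr in H.
transitivity (exp (Re u) * exp (Re u) *
  (sin (Im u) * sin (Im u) + cos (Im u) * cos (Im u))); [ring|rewrite H; ring].
Qed.

Lemma Clog_Cexp (u : C) : - (PI / 2) < Im u < PI / 2 -> Clog (Cexp u) = u.
Proof.
intros Hu.
assert (Hc : 0 < cos (Im u)) by (apply cos_gt_0; lra).
unfold Clog.
rewrite Cmod_Cexp, ln_exp, Carg_atan.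
2: { simpl; apply Rmult_lt_0_compat; [apply exp_pos|exact Hc]. }
replace (Im (Cexp u) / Re (Cexp u)) with (tan (Im u)).
{ rewrite atan_tan by assumption. destruct u; reflexivity. }
simpl; unfold tan; pose proof (exp_pos (Re u)); field; lra.
Qed.

Lemma Im_Clog_bound (w : C) : 0 < Re w -> - (PI / 2) < Im (Clog w) < PI / 2.
Proof.
intros Hw; simpl; rewrite Carg_atan by exact Hw.
pose proof (atan_bound (Im w / Re w)); lra.
Qed.

Lemma Cexp_plus (u v : C) : Cexp (u + v)%C = (Cexp u * Cexp v)%C.
Proof.
destruct u, v; unfold Cexp, Cmult; simpl; rewrite exp_plus, cos_plus, sin_plus.
f_equal; ring.
Qed.

(** * Derivatives of the exponential, logarithm and inverse; chain and product rules *)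

Lemma Cmod_le_Rabs (x y : R) : Cmod (x, y) <= Rabs x + Rabs y.
Proof.
pose proof (Cmod_triangle (x, 0) (0, y)) as H.
assert (H1 : Cmod (x, 0) = Rabs x) by apply Cmod_R.
assert (H2 : Cmod (0, y) = Rabs y).
{ unfold Cmod; simpl. rewrite <- sqrt_Rsqr_abs; f_equal; unfold Rsqr; ring. }
rewrite H1, H2 in H.
unfold Cplus in H; simpl in H; rewrite Rplus_0_r, Rplus_0_l in H; exact H.
Qed.

Lemma derivable_pt_lim_bound (f : R -> R) (l eps : R) :
  derivable_pt_lim f 0 l -> 0 < eps ->
  exists d, 0 < d /\ forall h, Rabs h < d ->
    Rabs (f h - f 0 - l * h) <= eps * Rabs h.
Proof.
intros Hf He; destruct (Hf eps He) as [d Hd].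
exists d; split; [apply cond_pos|].
intros h Hh; destruct (Req_dec h 0) as [->|h0].
- replace (f 0 - f 0 - l * 0) with 0 by ring. rewrite Rabs_R0; lra.
- specialize (Hd h h0 Hh). rewrite Rplus_0_l in Hd.
  replace (f h - f 0 - l * h) with (((f h - f 0) / h - l) * h) by (field; exact h0).
  rewrite Rabs_mult. apply Rmult_le_compat_r; [apply Rabs_pos|lra].
Qed.

Lemma Cexp_expansion_0 (eps : R) : 0 < eps ->
  exists d, 0 < d /\ forall h : C, Cmod h < d ->
    Cmod (Cexp h - 1 - h)%C <= eps * Cmod h.
Proof.
intros He.
(* The two components of the remainder are bounded by [e |x| + 2 e |y|] and [e |x| + 3 e |y|], in
   all at most [7 e |h|]; [e <= 1] gives [|1 + x| <= 2]. *)
set (e := Rmin 1 (eps / 7)).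
assert (e0 : 0 < e) by (apply Rmin_pos; lra).
assert (e1 : e <= 1) by apply Rmin_l.
assert (e2 : e <= eps / 7) by apply Rmin_r.
destruct (derivable_pt_lim_bound exp 1 e) as (d1 & d10 & H1); [|exact e0|].
{ rewrite <- exp_0; apply derivable_pt_lim_exp. }
destruct (derivable_pt_lim_bound sin 1 e) as (d2 & d20 & H2); [|exact e0|].
{ rewrite <- cos_0; apply derivable_pt_lim_sin. }
destruct (derivable_pt_lim_bound cos 0 e) as (d3 & d30 & H3); [|exact e0|].
{ replace 0 with (- sin 0) at 2 by (rewrite sin_0; ring).
  apply derivable_pt_lim_cos. }
exists (Rmin e (Rmin d1 (Rmin d2 d3))); split.
{ apply Rmin_pos; [exact e0|]; repeat apply Rmin_pos; assumption. }
intros [x y] Hh.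
pose proof (Rmin_l e (Rmin d1 (Rmin d2 d3))).
pose proof (Rmin_r e (Rmin d1 (Rmin d2 d3))).
pose proof (Rmin_l d1 (Rmin d2 d3)).
pose proof (Rmin_r d1 (Rmin d2 d3)).
pose proof (Rmin_l d2 d3).
pose proof (Rmin_r d2 d3).
pose proof (Rmax_Cmod (x, y)) as Hm; simpl in Hm.
pose proof (Rmax_l (Rabs x) (Rabs y)).
pose proof (Rmax_r (Rabs x) (Rabs y)).
specialize (H1 x ltac:(lra)); specialize (H2 y ltac:(lra));
  specialize (H3 y ltac:(lra)).
rewrite exp_0 in H1; rewrite sin_0 in H2; rewrite cos_0 in H3.
assert (Hx : Rabs x <= e) by lra.
assert (Hcos : Rabs (cos y) <= 1) by (apply Rabs_le_between, COS_bound).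
assert (Hsin : Rabs (sin y) <= 1) by (apply Rabs_le_between, SIN_bound).
assert (Hx1 : Rabs (1 + x) <= 2).
{ eapply Rle_trans; [apply Rabs_triang|]; rewrite Rabs_R1; lra. }
pose proof (Rabs_pos x); pose proof (Rabs_pos y).
assert (A1 : Rabs (exp x * cos y - 1 - x) <= e * Rabs x + 2 * (e * Rabs y)).
{ replace (exp x * cos y - 1 - x) with
    ((exp x - 1 - 1 * x) * cos y + (1 + x) * (cos y - 1 - 0 * y)) by ring.
  eapply Rle_trans; [apply Rabs_triang|]; rewrite !Rabs_mult.
  apply Rplus_le_compat.
  - rewrite <- (Rmult_1_r (e * Rabs x)).
    apply Rmult_le_compat; try apply Rabs_pos; assumption.
  - apply Rmult_le_compat; try apply Rabs_pos; assumption. }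
assert (A2 : Rabs (exp x * sin y - y) <= e * Rabs x + 2 * (e * Rabs y) + e * Rabs y).
{ replace (exp x * sin y - y) with
    ((exp x - 1 - 1 * x) * sin y + (1 + x) * (sin y - 0 - 1 * y) + x * y) by ring.
  eapply Rle_trans; [apply Rabs_triang|].
  apply Rplus_le_compat.
  - eapply Rle_trans; [apply Rabs_triang|]; rewrite !Rabs_mult.
    apply Rplus_le_compat.
    + rewrite <- (Rmult_1_r (e * Rabs x)).
      apply Rmult_le_compat; try apply Rabs_pos; assumption.
    + apply Rmult_le_compat; try apply Rabs_pos; assumption.
  - rewrite Rabs_mult; apply Rmult_le_compat_r; assumption. }
replace (Cexp (x, y) - 1 - (x, y))%C with (exp x * cos y - 1 - x, exp x * sin y - y).
2: { unfold Cexp, Cminus, Cplus, Copp; simpl; f_equal; ring. }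
eapply Rle_trans; [apply Cmod_le_Rabs|].
apply Rle_trans with (7 * e * Cmod (x, y)); [|apply Rmult_le_compat_r; [apply Cmod_ge_0|lra]].
assert (e * Rabs x <= e * Cmod (x, y)) by (apply Rmult_le_compat_l; lra).
assert (e * Rabs y <= e * Cmod (x, y)) by (apply Rmult_le_compat_l; lra).
lra.
Qed.

Lemma is_derive_Cexp (z : C) :
  is_derive (K := C_AbsRing) (V := C_NormedModule) Cexp z (Cexp z).
Proof.
apply is_derive_C_iff; intros eps He.
pose proof (Cmod_ge_0 (Cexp z)) as Hz.
destruct (Cexp_expansion_0 (eps / (Cmod (Cexp z) + 1))) as (d & d0 & Hd).
{ apply Rdiv_lt_0_compat; lra. }
exists d; split; [exact d0|]; intros h Hh; specialize (Hd h Hh).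
rewrite Cexp_plus.
replace (Cexp z * Cexp h - Cexp z - h * Cexp z)%C with (Cexp z * (Cexp h - 1 - h))%C
  by ring.
rewrite Cmod_mult.
apply Rle_trans with ((Cmod (Cexp z) + 1) *
  (eps / (Cmod (Cexp z) + 1) * Cmod h)).
- apply Rmult_le_compat; try apply Cmod_ge_0; lra.
- right; field; lra.
Qed.

Lemma Rabs_atan_le (t : R) : Rabs (atan t) <= Rabs t.
Proof.
assert (Hpos : forall x, 0 < x -> 0 <= atan x <= x).
{ intros x Hx.
  destruct (MVT_cor2 atan (fun y => / (1 + y ^ 2)) 0 x Hx) as (c & Hc & _).
  { intros; apply derivable_pt_lim_atan. }
  rewrite atan_0 in Hc.
  assert (H : 0 < / (1 + c ^ 2) <= 1).
  { pose proof (pow2_ge_0 c); split; [apply Rinv_0_lt_compat; lra|].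
    rewrite <- Rinv_1 at 2; apply Rinv_le_contravar; lra. }
  nra. }
destruct (Rtotal_order t 0) as [H|[->|H]].
- specialize (Hpos (- t) ltac:(lra)); rewrite atan_opp in Hpos.
  rewrite (Rabs_left t) by lra; rewrite Rabs_left1; lra.
- rewrite atan_0; lra.
- specialize (Hpos t H); rewrite !Rabs_pos_eq; lra.
Qed.

(** The argument and the logarithm of the modulus contribute [2 |h|] each. This crude bound lets the
    expansion of [Cexp] at 0 be applied to [Clog (1 + h)]. *)
Lemma Cmod_Clog_le (h : C) : Cmod h <= 1 / 2 -> Cmod (Clog (1 + h)%C) <= 4 * Cmod h.
Proof.
intros Hh.
pose proof (Rmax_Cmod h) as Hm.
pose proof (Rmax_l (Rabs (fst h)) (Rabs (snd h))).
pose proof (Rmax_r (Rabs (fst h)) (Rabs (snd h))).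
pose proof (Cmod_ge_0 h).
assert (Hre : 1 / 2 <= Re (1 + h)%C).
{ simpl. pose proof (Rle_abs (- fst h)) as Ha; rewrite Rabs_Ropp in Ha.
  unfold Re; lra. }
unfold Clog; eapply Rle_trans; [apply Cmod_le_Rabs|].
assert (A : Rabs (Carg (1 + h)%C) <= 2 * Cmod h).
{ rewrite Carg_atan by lra.
  eapply Rle_trans; [apply Rabs_atan_le|].
  rewrite Rabs_div, (Rabs_pos_eq (Re (1 + h)%C)) by lra.
  apply Rle_div_l; [lra|].
  replace (Im (1 + h)%C) with (snd h) by (simpl; unfold Im; ring).
  nra. }
assert (B : Rabs (ln (Cmod (1 + h)%C)) <= 2 * Cmod h).
{ set (m := Cmod (1 + h)%C).
  assert (m1 : m <= 1 + Cmod h)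
    by (unfold m; eapply Rle_trans; [apply Cmod_triangle|rewrite Cmod_1; lra]).
  assert (m2 : 1 - Cmod h <= m).
  { pose proof (Cmod_triangle (1 + h)%C (- h)%C) as T.
    replace (1 + h + - h)%C with (RtoC 1) in T by ring.
    rewrite Cmod_1, Cmod_opp in T; unfold m; lra. }
  assert (m0 : 0 < m) by lra.
  assert (U : ln m <= m - 1).
  { pose proof (exp_ineq1_le (ln m)) as U; rewrite exp_ln in U; lra. }
  assert (V : - ln m <= / m - 1).
  { pose proof (exp_ineq1_le (- ln m)) as V.
    rewrite exp_Ropp, exp_ln in V; lra. }
  assert (W : / m <= 1 + 2 * Cmod h).
  { apply Rmult_le_reg_l with m; [lra|]. rewrite Rinv_r by lra. nra. }
  apply Rabs_le_between; lra. }
lra.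
Qed.

(** The difference [D] of the logarithms satisfies [Cexp D = 1 + h] and [|Im D| < PI]. Since
    [Re (1 + h) > 0], [cos (Im D) > 0] sharpens this to [|Im D| < PI / 2], so [D] is the principal
    logarithm. *)
Lemma Clog_mult_small (z h : C) : 0 < Re z -> 0 < Re (z * (1 + h))%C ->
  Cmod h <= 1 / 2 -> Clog (z * (1 + h))%C = (Clog z + Clog (1 + h))%C.
Proof.
intros Hz Hzh Hh.
assert (Hre : 0 < Re (1 + h)%C).
{ pose proof (re_le_Cmod h) as H.
  pose proof (Rle_abs (- Re h)) as Ha; rewrite Rabs_Ropp in Ha.
  replace (Re (1 + h)%C) with (1 + Re h) by (destruct h; reflexivity). lra. }
set (D := (Clog (z * (1 + h)) - Clog z)%C).
assert (HE : Cexp D = (1 + h)%C).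
{ assert (z0 : z <> RtoC 0) by (intros E; rewrite E in Hz; simpl in Hz; lra).
  assert (E : (z * Cexp D)%C = (z * (1 + h))%C).
  { rewrite <- (Cexp_Clog z Hz) at 1. rewrite <- Cexp_plus.
    rewrite <- (Cexp_Clog _ Hzh). f_equal. unfold D; ring. }
  transitivity (/ z * (z * Cexp D))%C; [|rewrite E]; field; exact z0. }
assert (HD : - PI < Im D < PI).
{ pose proof (Im_Clog_bound z Hz) as B1; pose proof (Im_Clog_bound _ Hzh) as B2.
  unfold D; revert B1 B2.
  generalize (Clog z) (Clog (z * (1 + h))%C); intros u v; destruct u, v; simpl; intros; lra. }
assert (Hcos : 0 < cos (Im D)).
{ rewrite <- HE in Hre.
  change (0 < exp (Re D) * cos (Im D)) in Hre.
  apply Rmult_lt_reg_l with (exp (Re D)); [apply exp_pos|lra]. }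
assert (HD2 : - (PI / 2) < Im D < PI / 2).
{ split; apply Rnot_le_lt; intros H.
  - pose proof (cos_le_0 (- Im D)); rewrite cos_neg in *; lra.
  - pose proof (cos_le_0 (Im D)); lra. }
assert (E : Clog (1 + h)%C = D) by (rewrite <- HE; apply Clog_Cexp, HD2).
rewrite E; unfold D; ring.
Qed.

(** With [h = z k] and [L = Clog (1 + k)], the remainder is exactly [- (Cexp L - 1 - L)], which is
    small because [|L| <= 4 |k|]. *)
Lemma is_derive_Clog (z : C) : 0 < Re z ->
  is_derive (K := C_AbsRing) (V := C_NormedModule) Clog z (/ z)%C.
Proof.
intros Hz; apply is_derive_C_iff; intros eps He.
assert (z0 : z <> RtoC 0) by (intros E; rewrite E in Hz; simpl in Hz; lra).
assert (Hm : 0 < Cmod z) by (apply Cmod_gt_0, z0).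
destruct (Cexp_expansion_0 (eps * Cmod z / 4)) as (d & d0 & Hd).
{ apply Rdiv_lt_0_compat; [apply Rmult_lt_0_compat|]; lra. }
(* [Re z] keeps [z + h] in the right half-plane; the other bound gives [|k| < 1 / 2] and
   [4 |k| < d]. *)
set (delta := Rmin (Re z) (Cmod z * Rmin (1 / 2) (d / 4))).
exists delta.
assert (H1 : delta <= Re z) by apply Rmin_l.
assert (H2 : delta <= Cmod z * Rmin (1 / 2) (d / 4)) by apply Rmin_r.
pose proof (Rmin_l (1 / 2) (d / 4)) as H3.
pose proof (Rmin_r (1 / 2) (d / 4)) as H4.
split.
{ apply Rmin_pos; [exact Hz|]. apply Rmult_lt_0_compat; [lra|]. apply Rmin_pos; lra. }
intros h Hh.
set (k := (h / z)%C).
assert (Hk : h = (z * k)%C) by (unfold k; field; exact z0).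
assert (Hmk : Cmod h = Cmod z * Cmod k) by (rewrite Hk at 1; apply Cmod_mult).
assert (Hk1 : Cmod k < Rmin (1 / 2) (d / 4)).
{ apply Rmult_lt_reg_l with (Cmod z); lra. }
assert (Hpos : 0 < Re (z * (1 + k))%C).
{ replace (z * (1 + k))%C with (z + h)%C by (rewrite Hk at 1; ring).
  pose proof (re_le_Cmod h).
  pose proof (Rle_abs (- Re h)) as Ha; rewrite Rabs_Ropp in Ha.
  replace (Re (z + h)%C) with (Re z + Re h) by (destruct z, h; reflexivity).
  lra. }
replace (z + h)%C with (z * (1 + k))%C by (rewrite Hk at 1; ring).
rewrite Clog_mult_small by (assumption || lra).
set (L := Clog (1 + k)%C).
replace (Clog z + L - Clog z - h * / z)%C with (- (Cexp L - 1 - L))%C.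
2: { unfold L at 1; rewrite Cexp_Clog.
  - unfold k; field; exact z0.
  - pose proof (re_le_Cmod k).
    pose proof (Rle_abs (- Re k)) as Ha; rewrite Rabs_Ropp in Ha.
    replace (Re (1 + k)%C) with (1 + Re k) by (destruct k; reflexivity). lra. }
rewrite Cmod_opp.
assert (HL : Cmod L <= 4 * Cmod k) by (apply Cmod_Clog_le; lra).
eapply Rle_trans; [apply Hd; lra|].
rewrite Hmk.
apply Rle_trans with (eps * Cmod z / 4 * (4 * Cmod k)); [|right; field].
apply Rmult_le_compat_l; [|exact HL].
apply Rlt_le, Rdiv_lt_0_compat; [apply Rmult_lt_0_compat|]; lra.
Qed.

(** The remainder is exactly [h^2 / (z^2 (z + h))], and [|z + h| >= |z| / 2] for small [h]. *)
Lemma is_derive_Cinv (z : C) : z <> RtoC 0 ->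
  is_derive (K := C_AbsRing) (V := C_NormedModule) Cinv z (- / (z * z))%C.
Proof.
intros z0; apply is_derive_C_iff; intros eps He.
assert (Hm : 0 < Cmod z) by (apply Cmod_gt_0, z0).
set (delta := Rmin (Cmod z / 2) (eps * Cmod z ^ 3 / 2)).
exists delta; split.
{ apply Rmin_pos; [lra|].
  apply Rdiv_lt_0_compat; [apply Rmult_lt_0_compat|]; try lra.
  apply pow_lt, Hm. }
assert (H1 : delta <= Cmod z / 2) by apply Rmin_l.
assert (H2 : delta <= eps * Cmod z ^ 3 / 2) by apply Rmin_r.
intros h Hh.
assert (Hzh : Cmod z / 2 <= Cmod (z + h)%C).
{ pose proof (Cmod_triangle (z + h)%C (- h)%C) as T.
  replace (z + h + - h)%C with z in T by ring.
  rewrite Cmod_opp in T; lra. }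
assert (zh0 : (z + h)%C <> RtoC 0) by (apply Cmod_gt_0; lra).
replace (/ (z + h) - / z - h * - / (z * z))%C with (h * h / (z * z * (z + h)))%C
  by (field; auto).
assert (Hzz : (z * z * (z + h))%C <> RtoC 0) by (repeat apply Cmult_neq_0; assumption).
rewrite Cmod_div, !Cmod_mult by exact Hzz.
pose proof (Cmod_ge_0 h).
apply Rle_div_l.
{ repeat apply Rmult_lt_0_compat; lra. }
apply Rle_trans with (Cmod h * (eps * Cmod z ^ 3 / 2)).
{ apply Rmult_le_compat_l; lra. }
replace (Cmod h * (eps * Cmod z ^ 3 / 2)) with
  (eps * Cmod h * (Cmod z * Cmod z * (Cmod z / 2))) by field.
apply Rmult_le_compat_l; [apply Rmult_le_pos; lra|].
apply Rmult_le_compat_l; [apply Rmult_le_pos; lra|exact Hzh].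
Qed.

Local Notation ex_C_derive := (ex_derive (K := C_AbsRing) (V := C_NormedModule)).

Lemma ex_C_derive_comp (f g : C -> C) (z : C) :
  ex_C_derive f (g z) -> ex_C_derive g z -> ex_C_derive (fun x => f (g x)) z.
Proof.
intros [df Hf] [dg Hg].
apply is_derive_C_AbsRing in Hg.
eexists; apply (is_derive_comp f g z); eassumption.
Qed.

Lemma ex_C_derive_mult (f g : C -> C) (z : C) :
  ex_C_derive f z -> ex_C_derive g z -> ex_C_derive (fun x => f x * g x)%C z.
Proof.
intros [df Hf] [dg Hg].
apply is_derive_C_AbsRing in Hf; apply is_derive_C_AbsRing in Hg.
eexists; apply is_derive_C_AbsRing, (is_derive_mult f g z df dg Hf Hg).
intros n m; apply Cmult_comm.
Qed.

(** * The sector in logarithmic coordinates, and the Cayley transform *)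

(** By the addition formulas, the two forms at [Cexp u] are [exp (Re u)] times [sin (theta - Im u)]
    and [sin (theta + Im u)]. *)
Lemma Cexp_in_sector (theta : R) (u : C) :
  theta <= PI / 2 -> - theta < Im u < theta -> in_sector theta (Cexp u).
Proof.
intros Ht Hu; unfold in_sector; simpl; pose proof (exp_pos (Re u)) as He.
split.
- replace (sin theta * (exp (Re u) * cos (Im u)) +
    - cos theta * (exp (Re u) * sin (Im u)))
    with (exp (Re u) * sin (theta - Im u)) by (rewrite sin_minus; ring).
  apply Rmult_lt_0_compat; [exact He|apply sin_gt_0; lra].
- replace (sin theta * (exp (Re u) * cos (Im u)) +
    cos theta * (exp (Re u) * sin (Im u)))
    with (exp (Re u) * sin (theta + Im u)) by (rewrite sin_plus; ring).
  apply Rmult_lt_0_compat; [exact He|apply sin_gt_0; lra].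
Qed.

Lemma in_sector_Re (theta : R) (w : C) :
  0 < theta <= PI / 2 -> in_sector theta w -> 0 < Re w.
Proof.
intros Ht [H1 H2]; pose proof PI_RGT_0.
assert (0 < sin theta) by (apply sin_gt_0; lra).
apply Rmult_lt_reg_l with (sin theta); lra.
Qed.

(** Both sines [sin (theta - Im u)] and [sin (theta + Im u)] are positive; as [|Im u| < PI / 2],
    their arguments lie in [(- PI, PI)] and must be positive too. *)
Lemma in_sector_Clog (theta : R) (w : C) :
  0 < theta <= PI / 2 -> in_sector theta w -> - theta < Im (Clog w) < theta.
Proof.
intros Ht Hw; pose proof (in_sector_Re theta w Ht Hw) as Hre.
pose proof (Im_Clog_bound w Hre) as Hb.
rewrite <- (Cexp_Clog w Hre) in Hw; revert Hb Hw.
generalize (Clog w); intros u Hb [H1 H2].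
pose proof (exp_pos (Re u)) as He.
assert (E1 : 0 < sin (theta - Im u)).
{ apply Rmult_lt_reg_l with (exp (Re u)); [exact He|].
  rewrite sin_minus; revert H1; simpl; lra. }
assert (E2 : 0 < sin (theta + Im u)).
{ apply Rmult_lt_reg_l with (exp (Re u)); [exact He|].
  rewrite sin_plus; revert H2; simpl; lra. }
split; apply Rnot_le_lt; intros H.
- pose proof (sin_ge_0 (- (theta + Im u))) as H3.
  rewrite sin_neg in H3; lra.
- pose proof (sin_ge_0 (- (theta - Im u))) as H3.
  rewrite sin_neg in H3; lra.
Qed.

(** The real part equals [(1 - |z|^2) / |1 - z|^2]. *)
Lemma Re_cayley_pos (z : C) : unit_disc z -> 0 < Re ((1 + z) / (1 - z))%C.
Proof.
unfold unit_disc; intros Hz.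
assert (H : Cmod z ^ 2 < 1) by (pose proof (Cmod_ge_0 z); nra).
rewrite Cmod2_alt in H.
destruct z as [x y]; simpl in H.
assert (D : 0 < (1 - x) ^ 2 + y ^ 2) by nra.
replace (Re ((1 + (x, y)) / (1 - (x, y)))%C)
  with ((1 - (x ^ 2 + y ^ 2)) / ((1 - x) ^ 2 + y ^ 2)).
- apply Rdiv_lt_0_compat; lra.
- simpl; field; repeat split; nra.
Qed.

Lemma cayley_inv_unit_disc (w : C) :
  0 < Re w -> unit_disc ((w - 1) / (w + 1))%C.
Proof.
intros Hw; unfold unit_disc.
assert (H : Cmod (w - 1)%C < Cmod (w + 1)%C).
{ apply Cmod_lt_sqr; destruct w as [x y]; simpl in *; nra. }
pose proof (Cmod_ge_0 (w - 1)%C).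
rewrite Cmod_div by (apply Cmod_gt_0; lra).
apply Rlt_div_l; lra.
Qed.

Lemma Cdiv_0_r (z : C) : (z / RtoC 0)%C = RtoC 0.
Proof.
unfold Cdiv, Cinv; destruct z as [x y]; unfold Cmult, RtoC; simpl.
unfold Rdiv; rewrite Ropp_0; f_equal; ring.
Qed.

Lemma Im_RtoC_mult (a : R) (u : C) : Im (RtoC a * u)%C = a * Im u.
Proof. destruct u; simpl; ring. Qed.

Lemma sector_map_in_sector (alpha : R) (z : C) :
  0 < alpha <= 1 -> unit_disc z -> in_sector (alpha * (PI / 2)) (sector_map alpha z).
Proof.
intros Ha Hz; pose proof PI_RGT_0.
apply Cexp_in_sector; [nra|].
rewrite Im_RtoC_mult.
pose proof (Im_Clog_bound _ (Re_cayley_pos z Hz)) as B; nra.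
Qed.

(** * From the sector to subordination, and the three conditions *)

(** Analyticity of [sector_map alpha] is supplied by the subordination hypothesis of each
    condition. *)
Lemma sector_subordinate (alpha : R) (p : C -> C) :
  0 < alpha <= 1 -> analytic_on_disc p -> p (RtoC 0) = RtoC 1 ->
  analytic_on_disc (sector_map alpha) ->
  (forall z, unit_disc z -> in_sector (alpha * (PI / 2)) (p z)) ->
  subordinate p (sector_map alpha).
Proof.
intros Ha Hp Hp0 Hq Hsec; pose proof PI_RGT_0.
assert (Ht : 0 < alpha * (PI / 2) <= PI / 2) by nra.
(* [Cexp (u z)] is the power [p ^ (1 / alpha)]; dividing the argument by [alpha] opens the sector to
   the right half-plane. *)
set (u := fun z => (RtoC (/ alpha) * Clog (p z))%C).
assert (Hu : forall z, unit_disc z -> - (PI / 2) < Im (u z) < PI / 2).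
{ intros z Hz; unfold u; rewrite Im_RtoC_mult.
  pose proof (in_sector_Clog _ _ Ht (Hsec z Hz)).
  split; apply Rmult_lt_reg_l with alpha; try lra;
    rewrite <- Rmult_assoc, Rinv_r by lra; lra. }
assert (HP : forall z, unit_disc z -> 0 < Re (Cexp (u z))).
{ intros z Hz; apply Rmult_lt_0_compat; [apply exp_pos|].
  specialize (Hu z Hz); apply cos_gt_0; lra. }
assert (HP1 : forall z, unit_disc z -> (Cexp (u z) + 1)%C <> RtoC 0).
{ intros z Hz E; specialize (HP z Hz).
  apply (f_equal Re) in E.
  revert E HP; destruct (Cexp (u z)); simpl; intros; lra. }
split; [exact Hp|]; split; [exact Hq|].
exists (fun z => (Cexp (u z) - 1) / (Cexp (u z) + 1))%C.
split; [|split; [|split]].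
- intros z Hz.
  assert (HC : ex_C_derive (fun x => Cexp (u x)) z).
  { apply (ex_C_derive_comp Cexp).
    - eexists; apply is_derive_Cexp.
    - apply ex_C_derive_mult; [apply ex_derive_const|].
      apply (ex_C_derive_comp Clog); [|apply Hp, Hz].
      eexists; apply is_derive_Clog, (in_sector_Re _ _ Ht), Hsec, Hz. }
  apply ex_C_derive_mult.
  + apply (ex_derive_minus (V := C_NormedModule)); [exact HC|apply ex_derive_const].
  + apply (ex_C_derive_comp Cinv).
    * eexists; apply is_derive_Cinv, HP1, Hz.
    * apply (ex_derive_plus (V := C_NormedModule)); [exact HC|apply ex_derive_const].
- intros z Hz; apply cayley_inv_unit_disc, HP, Hz.
- assert (E : Cexp (u 0) = RtoC 1).
  { assert (L1 : Clog (RtoC 1) = RtoC 0).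
    { unfold Clog; rewrite Cmod_1, ln_1, Carg_atan by (simpl; lra).
      simpl; unfold Rdiv; rewrite Rmult_0_l, atan_0; reflexivity. }
    unfold u; rewrite Hp0, L1.
    replace (RtoC (/ alpha) * RtoC 0)%C with (RtoC 0) by ring.
    unfold Cexp; simpl; rewrite exp_0, cos_0, sin_0; unfold RtoC; f_equal; ring. }
  rewrite E; unfold Cdiv; ring.
- intros z Hz; unfold sector_map, Cpower.
  replace ((1 + (Cexp (u z) - 1) / (Cexp (u z) + 1)) /
    (1 - (Cexp (u z) - 1) / (Cexp (u z) + 1)))%C with (Cexp (u z)).
  2: { field; split.
    - apply HP1, Hz.
    - intros E; apply (f_equal Re) in E; revert E.
      destruct (Cexp (u z)); simpl; intros; lra. }
  rewrite Clog_Cexp by (apply Hu, Hz).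
  unfold u.
  replace (RtoC alpha * (RtoC (/ alpha) * Clog (p z)))%C with (Clog (p z)).
  2: { rewrite Cmult_assoc, <- RtoC_mult, Rinv_r by lra; ring. }
  rewrite Cexp_Clog; [reflexivity|].
  apply (in_sector_Re _ _ Ht), Hsec, Hz.
Qed.

(** Common frame of the three conditions, [h] being the left-hand side: a nonpositive form at the
    exit point contradicts [h z = sector_map alpha (w z)]. The premise [h z <> 0] serves to exclude
    [p z = 0] where [h] divides by [p]. *)
Lemma subordinate_of_exit (alpha : R) (p h : C -> C) :
  0 < alpha <= 1 -> analytic_on_disc p -> p (RtoC 0) = RtoC 1 ->
  subordinate h (sector_map alpha) ->
  (forall (z : C) (s k r : R), (s = 1 \/ s = -1) -> 0 <= k -> 0 <= r ->
    p z = (r * cos (alpha * (PI / 2)), s * (r * sin (alpha * (PI / 2)))) ->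
    (z * C_derive p z)%C =
      (- (k * sin (alpha * (PI / 2))), s * (k * cos (alpha * (PI / 2)))) ->
    h z <> RtoC 0 ->
    sin (alpha * (PI / 2)) * Re (h z) - s * cos (alpha * (PI / 2)) * Im (h z) <= 0) ->
  subordinate p (sector_map alpha).
Proof.
intros Ha Hp Hp0 (_ & Hq & w & _ & Hw & _ & Hhw) Hexit; pose proof PI_RGT_0.
apply sector_subordinate; try assumption.
apply NNPP; intros Hn.
destruct (sector_exit (alpha * (PI / 2)) p) as (z & s & k & r & Hz & Hs & Hk & Hr & E1 & E2);
  [nra|assumption..|].
assert (H0 : h z <> RtoC 0).
{ rewrite Hhw by exact Hz; apply sector_map_neq_0. }
specialize (Hexit z s k r Hs Hk Hr E1 E2 H0).
pose proof (sector_map_in_sector alpha (w z) Ha (Hw z Hz)) as [I1 I2].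
rewrite <- Hhw in I1, I2 by exact Hz.
destruct Hs as [-> | ->]; lra.
Qed.

Theorem theorem3p3 :
  forall (alpha : R) (p : C -> C),
    0 < alpha <= 1 ->
    analytic_on_disc p ->
    p (RtoC 0) = RtoC 1 ->
    (forall beta : R, 0 < beta ->
       subordinate (fun z : C => p z + RtoC beta * (z * C_derive p z))%C
                   (sector_map alpha) ->
       subordinate p (sector_map alpha))
    /\
    (forall beta : R, 0 < beta ->
       subordinate (fun z : C => p z + RtoC beta * (z * C_derive p z / p z))%C
                   (sector_map alpha) ->
       subordinate p (sector_map alpha))
    /\
    (forall beta : R,
       (0 < alpha < 1 / 2 /\ 0 < beta) \/ (1 / 2 < alpha <= 1 /\ beta < 0) ->
       subordinate
         (fun z : C => p z + RtoC beta * (z * C_derive p z / p z ^ 2))%C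
         (sector_map alpha) ->
       subordinate p (sector_map alpha)).
Proof.
intros alpha p Ha Hp Hp0; pose proof PI_RGT_0.
set (theta := alpha * (PI / 2)).
assert (Ht : 0 < theta <= PI / 2) by (unfold theta; nra).
pose proof (sin2_cos2 theta) as H1; unfold Rsqr in H1.
assert (Hcos : 0 <= cos theta) by (apply cos_ge_0; lra).
assert (Hr0 : forall (r s : R) (z : C), 0 <= r ->
  p z = (r * cos theta, s * (r * sin theta)) -> p z <> RtoC 0 -> 0 < r).
{ intros r s z [Hr|Hr] E Hn; [exact Hr|exfalso; apply Hn].
  rewrite E, <- Hr, !Rmult_0_l, Rmult_0_r; reflexivity. }
assert (Hdiv1 : forall u v : C, v <> RtoC 0 -> (u * v / v)%C = u)
  by (intros; field; assumption).
assert (Hdiv2 : forall u v : C, v <> RtoC 0 -> (u * (v * v) / v ^ 2)%C = u)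
  by (intros; field; assumption).
split; [|split]; intros beta Hb Hsub;
  apply (subordinate_of_exit alpha p _ Ha Hp Hp0 Hsub);
  intros z s k r Hs Hk Hr E1 E2 Hh; fold theta in E1, E2 |- *;
  assert (Hss : s * s = 1) by (destruct Hs as [-> | ->]; ring).
- rewrite E2, E1; simpl.
  (* The multiple [r exp (i s theta)] contributes nothing to the form, which takes the value [-1] at
     [i s exp (i s theta)]. *)
  match goal with |- ?X <= 0 => replace X with (- (beta * k)) end; [nra|].
  transitivity (r * cos theta * sin theta * (1 - s * s)
    - beta * k * (sin theta * sin theta + s * s * (cos theta * cos theta)));
    [rewrite Hss, Rmult_1_l, H1|]; ring.
(* Division by 0 yields 0, so [p z = 0] would give [h z = 0]. *)
- assert (Hpz : p z <> RtoC 0).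
  { intros E; apply Hh; rewrite E, Cdiv_0_r; ring. }
  assert (r0 : 0 < r) by exact (Hr0 r s z Hr E1 Hpz).
  (* The quotient of [i s k exp (i s theta)] by [r exp (i s theta)]. *)
  replace (z * C_derive p z / p z)%C with ((0, s * (k / r)) : C).
  2: { replace (z * C_derive p z)%C with ((0, s * (k / r))%R * p z)%C;
         [symmetry; apply Hdiv1, Hpz|].
       rewrite E1, E2; unfold Cmult; simpl; f_equal; [|field; lra].
       transitivity (- (s * s * (k * sin theta))); [field; lra|rewrite Hss; ring]. }
  rewrite E1; simpl.
  match goal with |- ?X <= 0 => replace X with (- (beta * (k / r) * cos theta)) end.
  + assert (0 <= beta * (k / r) * cos theta); [|lra].
    repeat apply Rmult_le_pos; try lra. apply Rlt_le, Rinv_0_lt_compat, r0.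
  + transitivity (r * cos theta * sin theta * (1 - s * s)
      - s * s * (beta * (k / r) * cos theta)); [rewrite Hss|]; ring.
- assert (Hpz : p z <> RtoC 0).
  { intros E; apply Hh; rewrite E.
    replace (RtoC 0 ^ 2)%C with (RtoC 0) by (simpl; ring).
    rewrite Cdiv_0_r; ring. }
  assert (r0 : 0 < r) by exact (Hr0 r s z Hr E1 Hpz).
  (* This value is [i s (k / r^2) exp (- i s theta)]; the reversed angle is what brings
     [cos (2 theta)] into the form. *)
  replace (z * C_derive p z / p z ^ 2)%C
    with ((k / (r * r) * sin theta, s * (k / (r * r) * cos theta)) : C).
  2: { replace (z * C_derive p z)%C with
         ((k / (r * r) * sin theta, s * (k / (r * r) * cos theta))%R * (p z * p z))%C;
         [symmetry; apply Hdiv2, Hpz|].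
       rewrite E1, E2; unfold Cmult; simpl.
       set (c := cos theta) in *; set (t := sin theta) in *; f_equal; symmetry.
       - transitivity (- (k * t) * (t * t + c * c)); [rewrite H1; ring|].
         transitivity (k * t * (c * c - (s * s) * (t * t))
           - 2 * (s * s) * (k * (c * c) * t)); [rewrite Hss; ring|field; lra].
       - transitivity (s * (k * c) * (t * t + c * c)); [rewrite H1; ring|].
         transitivity (s * (k * c) * (2 * (t * t) + c * c - (s * s) * (t * t)));
           [rewrite Hss; ring|field; lra]. }
  rewrite E1; simpl.
  match goal with |- ?X <= 0 => replace X with
    (- (beta * (k / (r * r)) * (cos theta * cos theta - sin theta * sin theta))) end.
  + rewrite <- cos_2a.
    assert (Hkr : 0 <= k / (r * r)).
    { apply Rmult_le_pos; [exact Hk|]. apply Rlt_le, Rinv_0_lt_compat; nra. }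
    (* [2 theta = alpha PI] is below [PI / 2] in the first case and in [(PI / 2, PI]] in the second,
       so the cosine changes sign along with [beta]. *)
    assert (0 <= beta * cos (2 * theta)); [|nra].
    unfold theta; destruct Hb as [[Hal Hb]|[Hal Hb]].
    * apply Rmult_le_pos; [lra|apply cos_ge_0; nra].
    * assert (cos (2 * (alpha * (PI / 2))) <= 0) by (apply cos_le_0; nra). nra.
  + transitivity (r * cos theta * sin theta * (1 - s * s)
      - beta * (k / (r * r)) * (s * s * (cos theta * cos theta) - sin theta * sin theta));
      [rewrite Hss|]; ring.
Qed.
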